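(* Let $n\ge 0$ and $d\ge n+1$ be integers, $p$ a prime, and let ${\bf a}_1,\dots,{\bf a}_N\in{\mathbb N}^{n+1}$ be distinct vectors, each with coordinate sum $d$, such that for some $M\le N$ the set $\{{\bf a}_k\}_{k=1}^M$ equals the set $U$ of all vectors in ${\mathbb N}^{n+1}$ with coordinate sum $d$ and all coordinates positive. For $i,j\in\{1,\dots,M\}$ let $\bar A_{ij}(\Lambda)\in{\mathbb F}_p[\Lambda_1,\dots,\Lambda_N]$ be the reduction mod $p$ of the coefficient of $x^{p{\bf a}_i-{\bf a}_j}$ in $\big(\sum_{k=1}^N\Lambda_kx^{{\bf a}_k}\big)^{p-1}$. Then for all $i,j=1,\dots,M$, $\bar A_{ij}(\Lambda)$ is a mod $p$ solution of the $A$-hypergeometric system associated to $\{{\bf a}_k^+\}_{k=1}^N$ with parameter $\beta=-{\bf a}_j^+$, i.e. it is annihilated, over ${\mathbb F}_p$, by all box operators $\Box_l$ ($l\in L$) and by all Euler operators $Z_0,\dots,Z_{n+1}$ for this $\beta$.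
   Context: ${\mathbb N}$ denotes the nonnegative integers. Write ${\bf a}_k=(a_{0k},\dots,a_{nk})$, ${\bf a}_k^+=(a_{0k},\dots,a_{nk},1)\in{\mathbb N}^{n+2}$, and $a_{n+1,k}=1$. Let $L=\{l\in{\mathbb Z}^N\mid\sum_{k=1}^Nl_k{\bf a}_k^+={\bf 0}\}$. The $A$-hypergeometric system with parameter $\beta=(\beta_0,\dots,\beta_{n+1})$ consists of the box operators $$\Box_l=\prod_{l_k>0}\Big(\frac{\partial}{\partial\Lambda_k}\Big)^{l_k}-\prod_{l_k<0}\Big(\frac{\partial}{\partial\Lambda_k}\Big)^{-l_k}\quad(l\in L)$$ and the Euler operators $$Z_i=\sum_{k=1}^Na_{ik}\Lambda_k\frac{\partial}{\partial\Lambda_k}-\beta_i\quad(i=0,\dots,n+1).$$ A mod $p$ solution (for $\beta\in{\mathbb Z}^{n+2}$) is one for which applying each of these operators gives $0$ modulo $p$. *)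

(* Defs.v *)
From mathcomp Require Export all_boot all_order all_algebra.
From mathcomp Require Export mpoly.

Set Implicit Arguments.
Unset Strict Implicit.
Unset Printing Implicit Defensive.

Import GRing.Theory.
Local Open Scope ring_scope.

Section AHypergeometric.

(* The set A is given by N vectors in NN^m, [A k i] being the i-th coordinate
   of the k-th vector; beta is an integral parameter. *)
Variables (N m : nat) (A : 'I_N -> 'I_m -> nat).

Definition lattice_rel (l : 'I_N -> int) : Prop :=
  forall i : 'I_m, \sum_(k < N) l k * (A k i)%:Z = 0.

Definition pos_part (l : 'I_N -> int) : 'X_{1..N} :=
  [multinom (if (0 < l k)%R then `|l k|%N else 0%N) | k < N].

Definition neg_part (l : 'I_N -> int) : 'X_{1..N} :=
  [multinom (if (l k < 0)%R then `|l k|%N else 0%N) | k < N].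

Definition box_op (R : comNzRingType) (l : 'I_N -> int) (f : {mpoly R[N]}) :
    {mpoly R[N]} :=
  mderivm (pos_part l) f - mderivm (neg_part l) f.

Definition euler_op (R : comNzRingType) (beta : 'I_m -> int) (i : 'I_m)
    (f : {mpoly R[N]}) : {mpoly R[N]} :=
  \sum_(k < N) (A k i)%:R *: ('X_k * mderiv k f) - (beta i)%:~R *: f.

Definition mod_p_solution (p : nat) (beta : 'I_m -> int)
    (f : {mpoly 'F_p[N]}) : Prop :=
  (forall l : 'I_N -> int, lattice_rel l -> box_op l f = 0) /\
  (forall i : 'I_m, euler_op beta i f = 0).

End AHypergeometric.

Definition aplus (n : nat) (u : 'X_{1..n.+1}) (i : 'I_n.+2) : nat :=
  if unlift ord_max i is Some i' then u i' else 1%N.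

(* Coefficient of a Laurent monomial x^e, e in ZZ^m, in a polynomial: it is 0
   as soon as some exponent e i is negative. *)
Definition laurent_coeff (R : nzRingType) (m : nat) (e : 'I_m -> int)
    (f : {mpoly R[m]}) : R :=
  if [forall i, 0 <= e i] then f@_[multinom `|e i|%N | i < m] else 0.

(* The polynomial sum_k Lambda_k x^(a_k), with integer coefficients, as a
   polynomial in x over ZZ[Lambda_1, ..., Lambda_N]. *)
Definition generic_poly (n N : nat) (a : 'I_N -> 'X_{1..n.+1}) :
    {mpoly {mpoly int[N]}[n.+1]} :=
  \sum_(k < N) ('X_k : {mpoly int[N]}) *: 'X_[a k].

Definition hasse_witt_entry (n N p : nat) (a : 'I_N -> 'X_{1..n.+1})
    (i j : 'I_N) : {mpoly int[N]} :=
  laurent_coeff (fun s => p%:Z * (a i s)%:Z - (a j s)%:Z)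
    (generic_poly a ^+ p.-1).

Definition hasse_witt_entry_mod (n N p : nat) (a : 'I_N -> 'X_{1..n.+1})
    (i j : 'I_N) : {mpoly 'F_p[N]} :=
  map_mpoly (intr : int -> 'F_p) (hasse_witt_entry p a i j).

(* Main.v *)
Require Import Defs.

(** Let [f] be the generic polynomial.  Since [d f^q / d Lambda_k] equals
    [q x^(a_k) f^(q-1)], the iterated derivative [d^u f^q] depends on [u] only
    through [|u|] and [sum_k u_k a_k], which agree on the positive and negative
    parts of a lattice relation, so the box operators kill [f^q].
    Homogeneity of [f^q] shows that on the coefficient of [x^(p a_i - a_j)] in
    [f^(p-1)] the Euler operators act as multiplication by [p a_i^+].  Both
    facts hold over the integers. *)

Set Implicit Arguments.
Unset Strict Implicit.
Unset Printing Implicit Defensive.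

Import GRing.Theory.
Local Open Scope ring_scope.

Section Multinomials.

Context {n : nat}.

Lemma multinom_ind (P : 'X_{1..n} -> Prop) :
  P 0%MM -> (forall k m, P m -> P (U_(k) + m)%MM) -> forall m, P m.
Proof.
move=> P0 PU m; elim: (mdeg m) {-2}m (erefl (mdeg m)) => {m} [|c IHc] m.
  by move/eqP; rewrite mdeg_eq0 => /eqP->.
move=> deg_m; have [k mk_neq0]: exists k, m k != 0%N.
  apply/existsP; rewrite -negb_forall; apply/negP => /forallP m_eq0.
  by move: deg_m; rewrite mdegE big1 // => k _; apply/eqP/m_eq0.
have Um : (U_(k) <= m)%MM by rewrite lep1mP.
rewrite -(submK Um) addmC; apply: PU; apply: IHc.
by move: deg_m; rewrite -{1}(submK Um) mdegD mdeg1 addn1 => -[].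
Qed.

Lemma mderiv_nat (R : nzRingType) (i : 'I_n) (c : nat) :
  (c%:R : {mpoly R[n]})^`M(i) = 0.
Proof. by rewrite raddfMn /= -mpolyC1 mderivC mul0rn. Qed.

Lemma mderiv_var (R : nzRingType) (i j : 'I_n) :
  ('X_j : {mpoly R[n]})^`M(i) = (j == i)%:R.
Proof.
rewrite mderivX mnm1E; have [->|_] := eqVneq j i; last by rewrite scale0r.
by rewrite scale1r -[X in (X - _)%MM]add0m addmK mpolyX0.
Qed.

(** Monomials are eigenvectors of [X_i d/dX_i], with eigenvalue the exponent of [X_i]. *)
Lemma mcoeff_mulX_mderiv (R : comNzRingType) (i : 'I_n) (m : 'X_{1..n})
    (f : {mpoly R[n]}) :
  ('X_i * f^`M(i))@_m = f@_m *+ m i.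
Proof.
elim/mpolyind: f => [|c u f _ _ IHf].
  by rewrite mderiv0 mulr0 !mcoeff0 mul0rn.
rewrite mderivD mulrDr !mcoeffD mulrnDl IHf; congr (_ + _).
rewrite mderivZ mderivX -!scalerAr -mpolyXD !mcoeffZ !mcoeffX.
(* If [u i] is 0, truncated subtraction prevents recovering [u] from [u - U_(i)], but the factor
   [u i] kills the term. *)
have [ui0|ui_neq0] := eqVneq (u i) 0%N.
  rewrite ui0 mul0r mulr0; have [u_m|_] := eqVneq u m.
    by rewrite -u_m ui0 mulr0n.
  by rewrite mulr0 mul0rn.
rewrite addmC submK ?lep1mP //; have [->|_] := eqVneq u m.
  by rewrite !mulr1 mulr_natr.
by rewrite !mulr0 mul0rn.
Qed.

Lemma map_mpoly_mderiv (R S : nzRingType) (h : {rmorphism R -> S}) (i : 'I_n)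
    (f : {mpoly R[n]}) :
  map_mpoly h f^`M(i) = (map_mpoly h f)^`M(i).
Proof.
by apply/mpolyP => m; rewrite mcoeff_map_mpoly !mcoeff_deriv mcoeff_map_mpoly raddfMn.
Qed.

Lemma map_mpoly_mderivm (R S : nzRingType) (h : {rmorphism R -> S})
    (u : 'X_{1..n}) (f : {mpoly R[n]}) :
  map_mpoly h f^`M[u] = (map_mpoly h f)^`M[u].
Proof.
elim/multinom_ind: u f => [|k u IHu] f; first by rewrite !mderivm0m.
by rewrite !mderivmDm IHu !mderivmU1m map_mpoly_mderiv.
Qed.

End Multinomials.

Section ReductionOfOperators.

Variables (N m : nat) (A : 'I_N -> 'I_m -> nat).
Variables (R S : comNzRingType) (h : {rmorphism R -> S}).

(** With its Euler analogue below, this lets the identities be proved over the integers and only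
    then reduced mod p. *)
Lemma map_mpoly_box_op l f :
  map_mpoly h (box_op l f) = box_op l (map_mpoly h f) :> {mpoly S[N]}.
Proof. by rewrite /box_op raddfB /= !map_mpoly_mderivm. Qed.

Lemma map_mpoly_euler_op beta i f :
  map_mpoly h (euler_op A beta i f) = euler_op A beta i (map_mpoly h f).
Proof.
rewrite /euler_op raddfB raddf_sum /= map_mpolyZ rmorph_int; congr (_ - _).
apply: eq_bigr => k _.
by rewrite map_mpolyZ rmorph_nat rmorphM /= map_mpolyX map_mpoly_mderiv.
Qed.

End ReductionOfOperators.

Section CoefficientwiseDerivative.

Variables (N n : nat) (R : comNzRingType).
Implicit Types f g : {mpoly {mpoly R[N]}[n]}.

(** This is the derivation [d/dLambda_k] with the [x] variables held constant. Since [mderiv k] is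
    additive but not multiplicative, the Leibniz rule needs its own proof. *)
Definition pderiv (k : 'I_N) f : {mpoly {mpoly R[N]}[n]} :=
  map_mpoly (mderiv k) f.

Lemma mcoeff_pderiv k f e : (pderiv k f)@_e = (f@_e)^`M(k).
Proof. exact: mcoeff_map_mpoly. Qed.

Lemma pderivM k f g : pderiv k (f * g) = pderiv k f * g + f * pderiv k g.
Proof.
apply/mpolyP => e; rewrite mcoeffD mcoeff_pderiv !mcoeffM raddf_sum -big_split.
by apply: eq_bigr => q _ /=; rewrite mderivM !mcoeff_pderiv.
Qed.

Lemma pderivX k (b : 'X_{1..n}) : pderiv k 'X_[b] = 0.
Proof.
by apply/mpolyP => e; rewrite mcoeff_pderiv mcoeffX mcoeff0 mderiv_nat.
Qed.

Lemma pderiv_exp k f q :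
  pderiv k (f ^+ q.+1) = pderiv k f * f ^+ q *+ q.+1.
Proof.
elim: q => [|q IHq]; first by rewrite expr1 expr0 mulr1.
by rewrite exprS pderivM IHq mulrnAr mulrCA -exprS -mulrS.
Qed.

End CoefficientwiseDerivative.

Section PowersOfGenericPolynomial.

Variables (n N : nat) (a : 'I_N -> 'X_{1..n.+1}).
Local Notation f := (generic_poly a).

Lemma pderiv_generic_poly k : pderiv k f = 'X_[a k].
Proof.
apply/mpolyP => e; rewrite mcoeff_pderiv mcoeffX raddf_sum raddf_sum /=.
rewrite (bigD1 k) //= big1 ?addr0 => [|j j_neq_k].
  by rewrite mcoeffZ mcoeffX mderivM mderiv_nat mulr0 addr0 mderiv_var eqxx
    mul1r.
by rewrite mcoeffZ mcoeffX mderivM mderiv_nat mulr0 addr0 mderiv_var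
  (negPf j_neq_k) mul0r.
Qed.

(** The factor ['X_[b]] makes the formula iterable: each derivative adds [a k] to [b]. At [q = 0]
    both sides vanish, so the truncated [q.-1] is harmless. *)
Lemma mderiv_mcoeff_generic_exp k b q e :
  (('X_[b] * f ^+ q)@_e)^`M(k) = ('X_[b + a k] * f ^+ q.-1)@_e *+ q.
Proof.
rewrite -mcoeff_pderiv pderivM pderivX mul0r add0r -mcoeffMn; congr (_@__).
case: q => [|q]; last by rewrite pderiv_exp pderiv_generic_poly mulrnAr mulrA -mpolyXD.
by rewrite expr0 -mpolyX0 pderivX mulr0.
Qed.

Definition weight (u : 'X_{1..N}) : 'X_{1..n.+1} :=
  (\sum_(k < N) a k *+ u k)%MM.

(** Iterating the previous lemma accumulates a falling factorial, which vanishes once [mdeg u]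
    exceeds [q], where the subtraction truncates. *)
Lemma mderivm_mcoeff_generic_exp (u : 'X_{1..N}) b q e :
  (('X_[b] * f ^+ q)@_e)^`M[u]
  = ('X_[b + weight u] * f ^+ (q - mdeg u))@_e *+ q ^_ (mdeg u).
Proof.
elim/(@multinom_ind N): u b q => [|k u IHu] b q.
  rewrite mderivm0m mdeg0 subn0 ffactn0 /weight big1 ?addm0 // => k _.
  by rewrite mnm0E mulm0n.
rewrite mderivmDm mderivmU1m mderiv_mcoeff_generic_exp mderivmMn IHu.
rewrite -mulrnA mdegD mdeg1 add1n ffactnS mulnC subnS predn_sub -addmA.
congr (('X_[_ + _] * _)@__ *+ _).
apply/mnmP => i; rewrite mnmDE !mnm_sumE (bigD1 k) //= [in RHS](bigD1 k) //=.
rewrite addnA !mulmnE mnmDE mnm1E eqxx mulnDr muln1; congr (_ + _)%N.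
apply: eq_bigr => j j_neq_k.
by rewrite !mulmnE mnmDE mnm1E eq_sym (negPf j_neq_k).
Qed.

(** Euler's identity: [f ^+ q] is homogeneous of degree [q] in the [Lambda_k]. *)
Lemma sum_mulX_mderiv_generic_exp q e :
  \sum_(k < N) 'X_k * ((f ^+ q)@_e)^`M(k) = (f ^+ q)@_e *+ q.
Proof.
under eq_bigr => k _.
  rewrite -[f ^+ q]mul1r -mpolyX0 mderiv_mcoeff_generic_exp add0m.
  rewrite mulrnAr -mcoeffZ scalerAl; over.
rewrite sumrMnl -raddf_sum -mulr_suml; case: q => [|q]; first by rewrite !mulr0n.
by rewrite exprS.
Qed.

(** The weighted Euler operator in [Lambda] and [x_i d/dx_i] agree on [f], hence on its powers, and
    the latter multiplies the coefficient of [x^e] by [e i]. *)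
Lemma sum_weighted_mulX_mderiv_generic_exp q e i :
  \sum_(k < N) (a k i)%:R *: ('X_k * ((f ^+ q)@_e)^`M(k))
  = (f ^+ q)@_e *+ e i.
Proof.
rewrite -mcoeff_mulX_mderiv.
under eq_bigr => k _.
  rewrite -[f ^+ q]mul1r -mpolyX0 mderiv_mcoeff_generic_exp add0m.
  rewrite mulrnAr -mcoeffZ scalerAl scaler_nat -!mcoeffMn -mulrnAl; over.
rewrite -raddf_sum; congr (_@__).
have f_deriv : 'X_i * f^`M(i) = \sum_(k < N) ('X_k *: 'X_[a k]) *+ a k i.
  rewrite raddf_sum mulr_sumr; apply: eq_bigr => k _ /=.
  apply/mpolyP => c; rewrite mcoeff_mulX_mderiv mcoeffMn !mcoeffZ mcoeffX.
  by have [->|_] := eqVneq (a k) c; rewrite ?mulr0 ?mul0rn.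
have exp_deriv : (f ^+ q)^`M(i) = f^`M(i) * f ^+ q.-1 *+ q.
  case: q => [|q] /=; first by rewrite expr0 -mpolyC1 mderivC.
  elim: q => [|q IHq]; first by rewrite expr1 expr0 mulr1.
  by rewrite exprS mderivM IHq mulrnAr mulrCA -exprS -mulrS.
rewrite exp_deriv mulrnAr mulrA f_deriv mulr_suml -sumrMnl.
by apply: eq_bigr => k _; rewrite !mulrnAl mulrnAC.
Qed.

End PowersOfGenericPolynomial.

Section HasseWittEntries.

Variables (n N p : nat) (a : 'I_N -> 'X_{1..n.+1}).
Hypothesis p_gt0 : (0 < p)%N.

Let ap k := aplus (a k).

Lemma lattice_rel_parts l :
  lattice_rel ap l ->
  mdeg (pos_part l) = mdeg (neg_part l)
  /\ weight a (pos_part l) = weight a (neg_part l).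
Proof.
move=> l_rel.
(* The difference of the two sides is the relation itself, as [l] is its positive part minus its
   negative part. *)
have parts s : (\sum_(k < N) pos_part l k * ap k s
                = \sum_(k < N) neg_part l k * ap k s)%N.
  apply/eqP; rewrite -eqz_nat -subr_eq0 !(big_morph _ PoszD (erefl _)) -sumrB.
  apply/eqP; rewrite -[RHS](l_rel s); apply: eq_bigr => k _.
  rewrite !mnmE !PoszM -mulrBl; congr (_ * _).
  by case: (l k) => [[|c]|c] /=; rewrite ?subr0 ?sub0r // NegzE.
split.
  (* The appended coordinate 1 gives equality of degrees; the other coordinates give equality of
     weights. *)
  move: (parts ord_max); rewrite !mdegE /ap /aplus unlift_none /=.
  by under eq_bigr do rewrite muln1; under [in RHS]eq_bigr do rewrite muln1.
apply/mnmP => i; move: (parts (lift ord_max i)); rewrite /ap /aplus liftK.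
rewrite !mnm_sumE => parts_i.
by under eq_bigr do rewrite mulmnE mulnC; under [in RHS]eq_bigr do rewrite mulmnE mulnC.
Qed.

Lemma box_op_hasse_witt_entry i j l :
  lattice_rel ap l -> box_op l (hasse_witt_entry p a i j) = 0.
Proof.
move=> /lattice_rel_parts[deg_parts weight_parts].
rewrite /box_op /hasse_witt_entry /laurent_coeff; case: ifP => _.
  rewrite -[_ ^+ _]mul1r -mpolyX0 !mderivm_mcoeff_generic_exp.
  by rewrite deg_parts weight_parts subrr.
by rewrite !raddf0 addr0.
Qed.

Lemma euler_op_hasse_witt_entry i j s :
  euler_op ap (fun t => - (ap j t)%:Z) s (hasse_witt_entry p a i j)
  = hasse_witt_entry p a i j *+ (p * ap i s).
Proof.
rewrite /euler_op /hasse_witt_entry /laurent_coeff; case: ifP => [e_ge0|_]; last first.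
  by rewrite scaler0 subr0 mul0rn big1 // => k _; rewrite mderiv0 mulr0 scaler0.
rewrite rmorphN scaleNr opprK scaler_int -pmulrn.
have [t ->|->] := unliftP ord_max s.
  rewrite /ap /aplus; under eq_bigr do rewrite liftK.
  rewrite !liftK sum_weighted_mulX_mderiv_generic_exp -mulrnDr mnmE.
  (* The eigenvalue is [(p a_i - a_j) + a_j] in coordinate [t], the second summand coming from
     [- beta]. *)
  congr (_ *+ _); apply/eqP; rewrite -eqz_nat PoszD PoszM gez0_abs ?subrK //.
  exact: (forallP e_ge0).
rewrite /ap /aplus; under eq_bigr do rewrite unlift_none scale1r.
(* In the last coordinate the degree [p.-1] and the shift 1 from [- beta] add up to [p]. *)
by rewrite !unlift_none sum_mulX_mderiv_generic_exp -mulrSr prednK // muln1.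
Qed.

End HasseWittEntries.

Theorem corollary3p11 (n d p N M : nat) (a : 'I_N -> 'X_{1..n.+1})
    (hd : (n.+1 <= d)%N) (hp : prime p)
    (a_inj : injective a)
    (a_deg : forall k : 'I_N, mdeg (a k) = d)
    (hMN : (M <= N)%N)
    (aU : forall u : 'X_{1..n.+1},
      (exists k : 'I_M, a (widen_ord hMN k) = u) <->
      (mdeg u = d /\ forall s : 'I_n.+1, (0 < u s)%N)) :
  forall i j : 'I_M,
    mod_p_solution (fun k => aplus (a k))
      (fun s : 'I_n.+2 => (- (aplus (a (widen_ord hMN j)) s)%:Z)%R)
      (hasse_witt_entry_mod p a (widen_ord hMN i) (widen_ord hMN j)).
Proof.
move=> i j; split=> [l l_rel|s]; rewrite /hasse_witt_entry_mod.
  by rewrite -map_mpoly_box_op box_op_hasse_witt_entry // raddf0.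
rewrite -map_mpoly_euler_op euler_op_hasse_witt_entry ?prime_gt0 //.
(* The eigenvalue is a multiple of [p], hence zero in ['F_p]. *)
apply/mpolyP => c; rewrite raddfMn mcoeffMn mcoeff0 mulrnA.
by rewrite -[_ *+ p]mulr_natr pchar_Fp_0 ?mulr0 ?mul0rn.
Qed.
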